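(* (i) Let $(A,\star,D)$ be an algebra over $F$ with a derivation $D$ that satisfies, for all $a,b,c\in A$, the identities $$a\star(b\star c)-(c\star b)\star a-2(b\cdot c)\cdot D(a)+4(a\cdot b)\cdot D(c)=0,\qquad (1)$$ $$(a\star b) \star c-a\star(b\star c)-\tfrac{1}{2}(a\star c)\star b+\tfrac{1}{2}(c\star a )\star b-2(a\cdot b)\cdot D(c)=0,\qquad (2)$$ where $a\cdot b= \frac{1}{2}(a\star b + b\star a)$. Then its polarization $(A,\cdot,[\,,],D)$ is both a generalized Poisson algebra and a transposed Poisson algebra. (ii) Conversely, if $(A,\cdot,[\,,],D)$ is both a generalized Poisson algebra and a transposed Poisson algebra, then its depolarization $(A,\star,D)$ satisfies the identities $(1)$ and $(2)$.
   Context: The base field $F$ is algebraically closed of characteristic $0$. Algebras are vector spaces with a bilinear product, not assumed associative or unital. A derivation of an algebra is a linear map satisfying the Leibniz (product) rule with respect to its multiplication. The polarization of $(A,\star,D)$ is $(A,\cdot,[\,,],D)$, where $a\cdot b=\frac12(a\star b+b\star a)$ and $[a,b]=\frac12(a\star b-b\star a)$. The depolarization of $(A,\cdot,[\,,],D)$, where $\cdot$ is commutative and $[\,,]$ is skew-symmetric, is $(A,\star,D)$ with $a\star b=a\cdot b+[a,b]$. $(A,\cdot,[\,,],D)$ is a generalized Poisson algebra if $(A,\cdot)$ is a commutative associative algebra, $(A,[\,,])$ is a Lie algebra, $D$ is a derivation of both $(A,\cdot)$ and $(A,[\,,])$, and for all $a,b,c\in A$ $$[a \cdot b, c] = a\cdot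 [b, c]+[a, c]\cdot b + a\cdot b\cdot D(c).$$ $(A,\cdot,[\,,])$ (or $(A,\cdot,[\,,],D)$) is a transposed Poisson algebra if $(A,\cdot)$ is a commutative associative algebra, $(A,[\,,])$ is a Lie algebra, and for all $a,b,c\in A$ $$2a\cdot [b,c] = [a\cdot b,c] + [b,a\cdot c].$$ *)

(* Defs.v *)
From HB Require Import structures.
From mathcomp Require Import all_boot all_order all_algebra.

Set Implicit Arguments.
Unset Strict Implicit.
Unset Printing Implicit Defensive.

Import GRing.Theory.
Local Open Scope ring_scope.

(* An algebra (not assumed associative or unital) on the vector space A is a
   product of type {bilinear A -> A -> A}. *)

Definition is_derivation (F : fieldType) (A : lmodType F)
    (mul : {bilinear A -> A -> A}) (D : {linear A -> A}) : Prop :=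
  forall a b, D (mul a b) = mul (D a) b + mul a (D b).

Definition polar_dot (F : fieldType) (A : lmodType F)
    (star : {bilinear A -> A -> A}) (a b : A) : A :=
  2^-1 *: (star a b + star b a).

Definition polar_bracket (F : fieldType) (A : lmodType F)
    (star : {bilinear A -> A -> A}) (a b : A) : A :=
  2^-1 *: (star a b - star b a).

Definition depolarization (F : fieldType) (A : lmodType F)
    (dot bracket : {bilinear A -> A -> A}) (a b : A) : A :=
  dot a b + bracket a b.

Fact polar_dot_bilinear (F : fieldType) (A : lmodType F)
  (star : {bilinear A -> A -> A}) :
  bilinear_for *:%R *:%R (polar_dot star).
Proof.
split=> c k a b; rewrite /= /polar_dot linearPl linearPr addrACA -scalerDr.
  by rewrite [LHS]scalerDr !scalerA mulrC.
by rewrite [LHS]scalerDr !scalerA mulrC.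
Qed.

Fact polar_bracket_bilinear (F : fieldType) (A : lmodType F)
  (star : {bilinear A -> A -> A}) :
  bilinear_for *:%R *:%R (polar_bracket star).
Proof.
split=> c k a b; rewrite /= /polar_bracket linearPl linearPr opprD addrACA.
  by rewrite -scalerBr [LHS]scalerDr !scalerA mulrC.
by rewrite -scalerBr [LHS]scalerDr !scalerA mulrC.
Qed.

Fact depolarization_bilinear (F : fieldType) (A : lmodType F)
  (dot bracket : {bilinear A -> A -> A}) :
  bilinear_for *:%R *:%R (depolarization dot bracket).
Proof.
by split=> c k a b; rewrite /= /depolarization ?linearPl ?linearPr addrACA
  -scalerDr.
Qed.

HB.instance Definition _ (F : fieldType) (A : lmodType F)
    (star : {bilinear A -> A -> A}) :=
  bilinear_isBilinear.Build F A A A *:%R *:%R (polar_dot star)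
    (polar_dot_bilinear star).

HB.instance Definition _ (F : fieldType) (A : lmodType F)
    (star : {bilinear A -> A -> A}) :=
  bilinear_isBilinear.Build F A A A *:%R *:%R (polar_bracket star)
    (polar_bracket_bilinear star).

HB.instance Definition _ (F : fieldType) (A : lmodType F)
    (dot bracket : {bilinear A -> A -> A}) :=
  bilinear_isBilinear.Build F A A A *:%R *:%R (depolarization dot bracket)
    (depolarization_bilinear dot bracket).

Definition comm_assoc_algebra (F : fieldType) (A : lmodType F)
    (dot : {bilinear A -> A -> A}) : Prop :=
  commutative dot /\ associative dot.

Definition lie_algebra (F : fieldType) (A : lmodType F)
    (bracket : {bilinear A -> A -> A}) : Prop :=
  (forall a, bracket a a = 0) /\
  (forall a b c, bracket a (bracket b c) + bracket b (bracket c a)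
                 + bracket c (bracket a b) = 0).

Definition generalized_Poisson (F : fieldType) (A : lmodType F)
    (dot bracket : {bilinear A -> A -> A}) (D : {linear A -> A}) : Prop :=
  [/\ comm_assoc_algebra dot,
      lie_algebra bracket,
      is_derivation dot D,
      is_derivation bracket D &
      forall a b c,
        bracket (dot a b) c
        = dot a (bracket b c) + dot (bracket a c) b + dot (dot a b) (D c)].

Definition transposed_Poisson (F : fieldType) (A : lmodType F)
    (dot bracket : {bilinear A -> A -> A}) : Prop :=
  [/\ comm_assoc_algebra dot,
      lie_algebra bracket &
      forall a b c,
        2 *: dot a (bracket b c) = bracket (dot a b) c + bracket b (dot a c)].

Definition identity1 (F : fieldType) (A : lmodType F)
    (star : {bilinear A -> A -> A}) (D : {linear A -> A}) : Prop :=
  let dot := polar_dot star in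
  forall a b c,
    star a (star b c) - star (star c b) a
    - 2 *: dot (dot b c) (D a) + 4 *: dot (dot a b) (D c) = 0.

Definition identity2 (F : fieldType) (A : lmodType F)
    (star : {bilinear A -> A -> A}) (D : {linear A -> A}) : Prop :=
  let dot := polar_dot star in
  forall a b c,
    star (star a b) c - star a (star b c)
    - 2^-1 *: star (star a c) b + 2^-1 *: star (star c a) b
    - 2 *: dot (dot a b) (D c) = 0.

(* Main.v *)
Require Import Defs.
From HB Require Import structures.
From mathcomp Require Import all_boot all_order all_algebra.
From mathcomp Require Import ring.

Import GRing.Theory.
Local Open Scope ring_scope.

(** Write D for the derivation, X.Y for the commutative product and [X,Y] for
    the skew one, so that star is X.Y + [X,Y].  The two mixed axioms and the
    two identities all meet in one pair of formulas, [wronskian_law]: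
      a.[b,c] = (a.c).D(b) - (a.b).D(c),
      [b.c,a] = (a.c).D(b) + (a.b).D(c) - (b.c).D(a).
    If there is a unit, the first one at a = 1 says that the bracket is the
    Wronskian c.D(b) - b.D(c), and the second one follows from this since D is
    a derivation.

    - [identity1], expanded, is twice the relation
        a.[b,c] - [b.c,a] - (b.c).D(a) + 2(a.b).D(c) = 0.
      Its parts skew and symmetric in b, c are the two formulas, so it is
      equivalent to [wronskian_law] ([identity1_wronskian]).
    - Direct substitution derives the generalized Leibniz rule and the
      transposed one from [wronskian_law].  For the converse, feeding one rule
      into the other gives b.[c,a] + c.[a,b] = (a.b).D(c) - (a.c).D(b); the
      cyclic sum of these kills a.[b,c] + b.[c,a] + c.[a,b], and subtracting
      leaves the formula for a.[b,c] ([Poisson_wronskian]).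
    - Modulo [wronskian_law] all mixed terms of [identity2] cancel, leaving
      (a.b).c - a.(b.c) = J(a,b,c), with J the Jacobi sum ([identity2E]).  J is
      invariant under cyclic permutations, while the cyclic sum of associators
      of a commutative product is zero; hence 3J = 0, and both sides vanish
      ([identity2_assoc_Jacobi]).

    Thus the two identities together are equivalent to the two Leibniz rules,
    associativity and the Jacobi identity.  A derivation of star is one of its
    symmetric and skew parts, because these are built linearly from star. *)

(** * Linear identities in a module by computation in a commutative ring *)

(** Nagata's idealization, in which A sits as an ideal of square zero.  It
    embeds A additively into a commutative ring, where [ring] decides the linear
    identities that hold between elements of A; the ring is an alias because
    the pair type must not carry two products when A is itself a ring. *)
Definition idealization {F : fieldType} (A : lmodType F) : Type := (F * A)%type.

HB.instance Definition _ (F : fieldType) (A : lmodType F) :=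
  GRing.Zmodule.copy (idealization A) (F * A)%type.

Section Idealization.
Context {F : fieldType} {A : lmodType F}.
Implicit Types p q r : idealization A.

Definition ideal_one : idealization A := (1, 0).
Definition ideal_mul p q : idealization A :=
  (p.1 * q.1, p.1 *: q.2 + q.1 *: p.2).

Fact ideal_mulA : associative ideal_mul.
Proof.
move=> p q r; rewrite /ideal_mul /= mulrA !scalerDr !scalerA addrA.
by rewrite (mulrC r.1 p.1) (mulrC r.1 q.1).
Qed.

Fact ideal_mulC : commutative ideal_mul.
Proof. by move=> p q; rewrite /ideal_mul mulrC addrC. Qed.

Fact ideal_mul1 : left_id ideal_one ideal_mul.
Proof. by move=> [k u]; rewrite /ideal_mul /= mul1r scale1r scaler0 addr0. Qed.

Fact ideal_mulD : left_distributive ideal_mul +%R.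
Proof.
move=> p q r; rewrite /ideal_mul /= mulrDl scalerDl scalerDr.
by rewrite addrACA.
Qed.

HB.instance Definition _ := GRing.Zmodule_isComPzRing.Build (idealization A)
  ideal_mulA ideal_mulC ideal_mul1 ideal_mulD.

Definition to_ideal (u : A) : idealization A := (0, u).

Fact to_ideal_zmod : zmod_morphism to_ideal.
Proof. by move=> u v; congr pair; rewrite /= subr0. Qed.

HB.instance Definition _ :=
  GRing.isZmodMorphism.Build A (idealization A) to_ideal to_ideal_zmod.

Lemma to_ideal_inj : injective to_ideal.
Proof. by move=> u v []. Qed.

End Idealization.

(** The scalars that occur are numerals, turned into natural multiples because
    [ring] pushes [to_ideal] through these. *)
Ltac additive_identity :=
  rewrite ?scaler_nat; apply: to_ideal_inj; ring.

(** * The Wronskian law and the two Leibniz rules *)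

Section WronskianLaw.
Context {F : fieldType} {A : lmodType F}.
Context (dot bracket : {bilinear A -> A -> A}) (D : {linear A -> A}).

Definition wronskian_law :=
  (forall a b c, dot a (bracket b c) = dot (dot a c) (D b) - dot (dot a b) (D c))
  /\ (forall a b c, bracket (dot b c) a =
        dot (dot a c) (D b) + dot (dot a b) (D c) - dot (dot b c) (D a)).

Context (dotC : commutative dot).
Context (brC : forall a b, bracket a b = - bracket b a).

Lemma wronskian_generalized_Leibniz a b c : wronskian_law ->
  bracket (dot a b) c
  = dot a (bracket b c) + dot (bracket a c) b + dot (dot a b) (D c).
Proof.
case=> dot_br br_dot; rewrite (dotC (bracket a c)) !dot_br br_dot.
by rewrite (dotC c b) (dotC c a) (dotC b a); additive_identity.
Qed.

Lemma wronskian_transposed_Leibniz a b c : wronskian_law ->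
  2 *: dot a (bracket b c) = bracket (dot a b) c + bracket b (dot a c).
Proof.
case=> dot_br br_dot; rewrite (brC b (dot a c)) dot_br !br_dot.
by rewrite (dotC c b) (dotC c a) (dotC b a); additive_identity.
Qed.

(** Each rule expresses brackets with a product inside through the products
    a.[b,c] and the terms with D, and they overlap: comparing them gives
    [two_terms], a linear system in a.[b,c], b.[c,a] and c.[a,b] that is
    invertible once 2 is. *)
Lemma Poisson_wronskian : 2 != 0 :> F ->
  (forall a b c, bracket (dot a b) c
     = dot a (bracket b c) + dot (bracket a c) b + dot (dot a b) (D c)) ->
  (forall a b c, 2 *: dot a (bracket b c)
     = bracket (dot a b) c + bracket b (dot a c)) ->
  wronskian_law.
Proof.
move=> two_neq0 GP TP.
have two_terms a b c : dot b (bracket c a) + dot c (bracket a b)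
    = dot (dot a b) (D c) - dot (dot a c) (D b).
  apply/eqP; rewrite -subr_eq0; apply/eqP.
  transitivity (2 *: dot a (bracket b c)
                - (bracket (dot a b) c + bracket b (dot a c)));
    last by rewrite -TP subrr.
  rewrite (brC b (dot a c)) !GP (dotC (bracket a c)) (dotC (bracket a b)).
  rewrite (brC a c) (brC c b) !linearNr /=.
  additive_identity.
have cyclic a b c :
    dot a (bracket b c) + dot b (bracket c a) + dot c (bracket a b) = 0.
  apply: (scalerI two_neq0); rewrite scaler0.
  transitivity ((dot b (bracket c a) + dot c (bracket a b))
    + (dot c (bracket a b) + dot a (bracket b c))
    + (dot a (bracket b c) + dot b (bracket c a))); first by additive_identity.
  rewrite !two_terms (dotC b a) (dotC c a) (dotC c b).
  additive_identity.
have dot_br a b c :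
    dot a (bracket b c) = dot (dot a c) (D b) - dot (dot a b) (D c).
  apply/eqP; rewrite -subr_eq0 -(cyclic a b c) -[X in _ == X]addrA two_terms.
  by apply/eqP; additive_identity.
split=> // a b c.
rewrite GP (dotC (bracket b a)) !dot_br (dotC b a) (dotC c a) (dotC c b).
additive_identity.
Qed.
End WronskianLaw.

(** * The identities of the product star in terms of its polarization *)

Section Depolarized.
Context {F : fieldType} {A : lmodType F}.
Context (star dot bracket : {bilinear A -> A -> A}) (D : {linear A -> A}).
Context (two_neq0 : 2 != 0 :> F).
Context (starE : forall a b, star a b = dot a b + bracket a b).
Context (dotC : commutative dot).
Context (brC : forall a b, bracket a b = - bracket b a).

Lemma polar_dotE a b : polar_dot star a b = dot a b.
Proof.
apply: (scalerI two_neq0); rewrite /polar_dot scalerA divff // scale1r !starE.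
by rewrite (dotC b) (brC b); additive_identity.
Qed.

Lemma polar_bracketE a b : polar_bracket star a b = bracket a b.
Proof.
apply: (scalerI two_neq0).
rewrite /polar_bracket scalerA divff // scale1r !starE.
by rewrite (dotC b) (brC b); additive_identity.
Qed.

(** The triple products and the nested brackets cancel: star a (star b c) and
    star (star c b) a differ by reversal, which changes the sign of exactly the
    terms with one bracket. *)
Lemma identity1E a b c :
  star a (star b c) - star (star c b) a
    - 2 *: polar_dot star (polar_dot star b c) (D a)
    + 4 *: polar_dot star (polar_dot star a b) (D c)
  = 2 *: (dot a (bracket b c) - bracket (dot b c) a
          - dot (dot b c) (D a) + 2 *: dot (dot a b) (D c)).
Proof.
rewrite !polar_dotE !starE !(linearDl, linearDr) /=.
rewrite (dotC c b) (brC c b) (brC a (dot b c)) (brC a (bracket b c)).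
rewrite !linearNl /= (dotC (dot b c) a) (dotC (bracket b c) a).
additive_identity.
Qed.

(** The relation of [identity1E] at (a,b,c) and at (a,c,b), subtracted and
    added, gives the two formulas. *)
Lemma identity1_wronskian : identity1 star D <-> wronskian_law dot bracket D.
Proof.
split=> [id1|[dot_br br_dot] dotS a b c].
  have half_id1 a b c : dot a (bracket b c) - bracket (dot b c) a
          - dot (dot b c) (D a) + 2 *: dot (dot a b) (D c) = 0.
    by apply: (scalerI two_neq0); rewrite scaler0 -identity1E; apply: id1.
  split=> a b c; apply: (scalerI two_neq0); apply/eqP; rewrite -subr_eq0.
    apply/eqP; transitivity (0 - 0 : A); last exact: subr0.
    rewrite -{1}(half_id1 a b c) -(half_id1 a c b) (brC c) (dotC c b) linearNr /=.
    additive_identity.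
  apply/eqP; transitivity (- (0 + 0) : A); last by rewrite addr0 oppr0.
  rewrite -{1}(half_id1 a b c) -(half_id1 a c b) (brC c) (dotC c b) linearNr /=.
  additive_identity.
apply: etrans (identity1E a b c) _; rewrite dot_br br_dot (dotC a c).
apply/eqP; rewrite scaler_eq0; apply/orP; right; apply/eqP.
additive_identity.
Qed.

Definition jacobiator (u v w : A) :=
  bracket u (bracket v w) + bracket v (bracket w u) + bracket w (bracket u v).

(** The two terms with halves add up to - star [a,c] b; after that, the law
    evaluates every term with exactly one bracket, and the total cancels the
    last term on the left. *)
Lemma identity2E a b c : wronskian_law dot bracket D ->
  star (star a b) c - star a (star b c)
    - 2^-1 *: star (star a c) b + 2^-1 *: star (star c a) b
    - 2 *: polar_dot star (polar_dot star a b) (D c)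
  = dot (dot a b) c - dot a (dot b c) - jacobiator a b c.
Proof.
case=> dot_br br_dot.
have halfE : - (2^-1 *: star (star a c) b) + 2^-1 *: star (star c a) b
    = - star (bracket a c) b.
  rewrite -polar_bracketE /polar_bracket linearZl_LR /= linearBl scalerBr.
  by rewrite opprB addrC.
rewrite -(addrA (star (star a b) c - _)) halfE.
rewrite !polar_dotE !starE !(linearDl, linearDr) /= /jacobiator.
rewrite (brC a (dot b c)) (dotC (bracket a b)) (dotC (bracket a c)) !dot_br !br_dot.
rewrite (brC (bracket a b)) (brC c a) !linearNr /= (brC (bracket a c)).
rewrite (dotC c b) (dotC c a) (dotC b a).
additive_identity.
Qed.

(** Division by 3 separates the two sides of [identity2E]: the cyclic sum is
    3 times the Jacobi sum but zero on associators. *)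
Lemma identity2_assoc_Jacobi : 3%:R != 0 :> F -> wronskian_law dot bracket D ->
  identity2 star D <->
    associative dot /\ forall a b c, jacobiator a b c = 0.
Proof.
move=> three_neq0 law; split=> [id2|[dotA jac0] dotS a b c]; last first.
  by apply: etrans (identity2E a b c law) _; rewrite jac0 dotA !subrr.
have assoc_jac a b c : dot (dot a b) c - dot a (dot b c) = jacobiator a b c.
  by apply/eqP; rewrite -subr_eq0 -identity2E //; apply/eqP/id2.
have jac0 a b c : jacobiator a b c = 0.
  apply: (scalerI three_neq0); rewrite scaler0.
  transitivity (jacobiator a b c + jacobiator b c a + jacobiator c a b).
    by rewrite /jacobiator; additive_identity.
  rewrite -!assoc_jac (dotC (dot a b)) (dotC (dot b c)) (dotC (dot c a)).
  additive_identity.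
split=> // a b c; apply/esym/eqP; rewrite -subr_eq0.
by rewrite assoc_jac jac0.
Qed.

End Depolarized.

Theorem theorem4p2 (F : closedFieldType) (charF0 : [pchar F] =i pred0)
    (A : lmodType F) (D : {linear A -> A}) :
  (forall star : {bilinear A -> A -> A},
     is_derivation star D -> identity1 star D -> identity2 star D ->
     generalized_Poisson (polar_dot star) (polar_bracket star) D /\
     transposed_Poisson (polar_dot star) (polar_bracket star)) /\
  (forall dot bracket : {bilinear A -> A -> A},
     generalized_Poisson dot bracket D -> transposed_Poisson dot bracket ->
     identity1 (depolarization dot bracket) D /\
     identity2 (depolarization dot bracket) D).
Proof.
have nat_neq0 n : n.+1%:R != 0 :> F by rewrite (pcharf0P F).1.
have two_neq0 : 2 != 0 :> F := nat_neq0 1.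
split=> [star Dstar id1 id2|dot bracket GP TP].
  have dotC : commutative (polar_dot star).
    by move=> a b; rewrite /polar_dot addrC.
  have brC a b : polar_bracket star a b = - polar_bracket star b a.
    by rewrite /polar_bracket -scalerN opprB.
  have brxx a : polar_bracket star a a = 0.
    by rewrite /polar_bracket subrr scaler0.
  have starE a b : star a b = polar_dot star a b + polar_bracket star a b.
    apply: (scalerI two_neq0).
    rewrite scalerDr /polar_dot /polar_bracket !scalerA divff // !scale1r.
    additive_identity.
  have law := (identity1_wronskian _ _ _ D two_neq0 starE dotC brC).1 id1.
  have [dotA jac0] :=
    (identity2_assoc_Jacobi _ _ _ D two_neq0 starE dotC brC (nat_neq0 2) law).1 id2.
  have Ddot : is_derivation (polar_dot star) D.
    move=> a b; rewrite /polar_dot linearZ linearD !Dstar -scalerDr /=.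
    by congr (_ *: _); additive_identity.
  have Dbr : is_derivation (polar_bracket star) D.
    move=> a b; rewrite /polar_bracket linearZ linearB !Dstar -scalerDr /=.
    by congr (_ *: _); additive_identity.
  split; split=> // a b c.
    exact: wronskian_generalized_Leibniz.
  exact: (wronskian_transposed_Leibniz _ _ D).
case: GP => -[dotC dotA] [brxx jac0] _ _ GP; case: TP => _ _ TP.
have brC a b : bracket a b = - bracket b a.
  apply/eqP; rewrite -addr_eq0 -(brxx (a + b)) linearDl !linearDr /= !brxx.
  by rewrite add0r addr0.
have law := Poisson_wronskian _ _ _ dotC brC two_neq0 GP TP.
have starE a b : depolarization dot bracket a b = dot a b + bracket a b by [].
split; first exact/(identity1_wronskian _ _ _ D two_neq0 starE dotC brC).
exact/(identity2_assoc_Jacobi _ _ _ D two_neq0 starE dotC brC (nat_neq0 2) law).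
Qed.
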